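(* Let $\mathbb K$ be an algebraically closed field of characteristic zero, let $f(X)=X^r+a_{r-1}X^{r-1}+\dots+a_0\in\mathbb K[X]$ with $r>1$, and let $\varphi(X,Z)=Z^d+b_{d-1}(X)Z^{d-1}+\dots+b_1(X)Z+b_0(X)\in\mathbb K[X][Z]$ with $d>1$. Let $\mathcal B=\mathbb K[X,Y,Z]/(f(X)Y-\varphi(X,Z))$ and let $x$ be the image of $X$ in $\mathcal B$. Then the Derksen invariant of $\mathcal B$ is $HD(\mathcal B)=\mathbb K[x]$.
   Context: A derivation $D$ of a $\mathbb K$-algebra $A$ is locally nilpotent if for each $a\in A$ there is $n\in\mathbb N$ with $D^n(a)=0$. The Derksen invariant $HD(A)$ is the $\mathbb K$-subalgebra of $A$ generated by the union of the kernels of all nonzero locally nilpotent derivations of $A$. *)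

(* Defs.v *)
From HB Require Import structures.
From mathcomp Require Import all_boot all_order all_algebra.
From mathcomp Require Import generic_quotient ring_quotient.
From mathcomp Require Import boolp classical_sets.
From mathcomp Require Import mpoly.

Set Implicit Arguments.
Unset Strict Implicit.
Unset Printing Implicit Defensive.

Import GRing.Theory.
Local Open Scope ring_scope.
Local Open Scope quotient_scope.
Local Open Scope classical_set_scope.

Section Derksen.
Variables (K : fieldType) (A : comAlgType K).

Definition is_derivation (D : {linear A -> A}) : Prop :=
  forall a b : A, D (a * b) = D a * b + a * D b.

Definition locally_nilpotent (D : A -> A) : Prop :=
  forall a : A, exists n : nat, iter n D a = 0.

Definition nonzero_LND : set {linear A -> A} :=
  [set D | [/\ is_derivation D, locally_nilpotent D & exists a, D a != 0]].

Definition generated_subalgebra (G : set A) : set A :=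
  smallest (fun S : set A => GRing.subalg_closed (mem S)) G.

Definition derksen_invariant : set A :=
  generated_subalgebra (\bigcup_(D in nonzero_LND) [set a | D a = 0]).

End Derksen.
Arguments derksen_invariant [K] A.

(* K[a] inside A: the image of the evaluation morphism K[T] -> A, T |-> a. *)
Definition adjoin (K : fieldType) (A : comAlgType K) (a : A) : set A :=
  range (horner_alg a).

(* MathComp only provides the commutative ring structure on R / I. *)
Section QuotientAlgebra.
Variables (K : fieldType) (R : comAlgType K) (I : idealr R).
Local Notation Q := {ideal_quot I}.

Definition quot_scale (c : K) (u : Q) : Q := \pi_Q (c *: repr u).

Lemma pi_scale (c : K) (p : R) : quot_scale c (\pi_Q p) = \pi_Q (c *: p).
Proof.
rewrite /quot_scale; apply/eqP; rewrite -Quotient.idealrBE -scalerBr.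
rewrite -mulr_algl; apply: idealMr.
by rewrite Quotient.idealrBE reprK.
Qed.

Lemma quot_scaleA a b u : quot_scale a (quot_scale b u) = quot_scale (a * b) u.
Proof.
elim/quotW: u => p.
by rewrite (pi_scale b) (pi_scale a) (pi_scale (a * b)) scalerA.
Qed.

Lemma quot_scale1 : left_id 1 quot_scale.
Proof. by elim/quotW => p; rewrite (pi_scale 1) scale1r. Qed.

Lemma quot_scaleDr : right_distributive quot_scale +%R.
Proof.
move=> c; elim/quotW => p; elim/quotW => q.
by rewrite -rmorphD !(pi_scale c) scalerDr rmorphD.
Qed.

Lemma quot_scaleDl u : {morph quot_scale^~ u : a b / a + b}.
Proof.
elim/quotW: u => p a b.
by rewrite (pi_scale (a + b)) (pi_scale a) (pi_scale b) scalerDl rmorphD.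
Qed.

HB.instance Definition _ := GRing.Zmodule_isLmodule.Build K Q
  quot_scaleA quot_scale1 quot_scaleDr quot_scaleDl.

Lemma quot_scaleAl (c : K) (u v : Q) : c *: (u * v) = (c *: u) * v.
Proof.
elim/quotW: u => p; elim/quotW: v => q.
rewrite -rmorphM /GRing.scale /= (pi_scale c) (pi_scale c).
by rewrite -rmorphM scalerAl.
Qed.

HB.instance Definition _ := GRing.Lmodule_isLalgebra.Build K Q quot_scaleAl.
HB.instance Definition _ := GRing.Lalgebra_isComAlgebra.Build K Q.

End QuotientAlgebra.

Definition principal_ideal (R : comNzRingType) (g : R) : pred R :=
  fun p => `[< exists q : R, p = q * g >].

Section Danielewski.
Variable K : fieldType.
Implicit Types (f : {poly K}) (phi : {poly {poly K}}).

(* The variables X, Y, Z are 'X_0, 'X_1, 'X_2; phi(X,Z) in K[X][Z] is given as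
   a polynomial in Z whose coefficients are polynomials in X. *)
Definition varX : {mpoly K[3]} := 'X_(inord 0).
Definition varY : {mpoly K[3]} := 'X_(inord 1).
Definition varZ : {mpoly K[3]} := 'X_(inord 2).

Definition dan_equation f phi : {mpoly K[3]} :=
  horner_alg varX f * varY - (map_poly (horner_alg varX) phi).[varZ].

Lemma dan_ideal_closed f phi d :
  phi \is monic -> size phi = d.+1 -> (1 < d)%N ->
  idealr_closed (principal_ideal (dan_equation f phi)).
Proof.
move=> phi_monic phi_size d_gt1; split.
- by apply/asboolP; exists 0; rewrite mul0r.
- apply/asboolP => -[q /esym qE].
  pose v (i : 'I_3) : {poly K} := if i == inord 2 then 'X else 0.
  pose ev : {rmorphism {mpoly K[3]} -> {poly K}} := mmap (@polyC K) v.
  have in32 (k : nat) : (k < 2)%N -> (inord k == inord 2 :> 'I_3) = false.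
    move=> k2; apply/negbTE/eqP => /(congr1 val) /=.
    rewrite !inordK ?(ltn_trans k2) // => kE; by rewrite kE in k2.
  have evX : ev varX = 0 by rewrite /ev /varX /= mmapX mmap1U /v in32.
  have evY : ev varY = 0 by rewrite /ev /varY /= mmapX mmap1U /v in32.
  have evZ : ev varZ = 'X by rewrite /ev /varZ /= mmapX mmap1U /v eqxx.
  have evC p : ev (horner_alg varX p) = (horner_eval 0 p)%:P.
    rewrite /horner_eval; elim/poly_ind: p => [|p c IH].
      by rewrite horner0 !rmorph0.
    have -> : horner_alg varX (p * 'X + c%:P) = horner_alg varX p * varX + c%:A.
      by rewrite rmorphD rmorphM /= horner_algX horner_algC.
    rewrite hornerD hornerMX hornerC mulr0 add0r rmorphD rmorphM evX mulr0.
    by rewrite add0r -mul_mpolyC mulr1 /= mmapC.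
  have evphi : ev (map_poly (horner_alg varX) phi).[varZ]
             = map_poly (horner_eval 0) phi.
    rewrite -horner_map evZ -map_poly_comp.
    rewrite (eq_map_poly evC) (map_poly_comp polyC) -/(_ \Po _).
    by rewrite comp_polyXr.
  have : map_poly (horner_eval 0) phi \is a GRing.unit.
    apply/unitrPr; exists (- ev q); rewrite -evphi mulrN mulrC -mulrN.
    transitivity (ev 1); last by rewrite rmorph1.
    rewrite -qE /dan_equation rmorphM rmorphB rmorphM evY.
    by rewrite mulr0 sub0r.
  rewrite poly_unitE size_map_poly_id0 ?(monicP phi_monic); last first.
    by rewrite /horner_eval hornerC oner_eq0.
  by rewrite phi_size eqSS gtn_eqF // ltnW.
- move=> a p q /asboolP[p' ->] /asboolP[q' ->]; apply/asboolP.
  by exists (a * p' + q'); rewrite mulrDl mulrA.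
Qed.

Section Ring.
Variables (f : {poly K}) (phi : {poly {poly K}}) (d : nat).
Hypotheses (phi_monic : phi \is monic) (phi_size : size phi = d.+1).
Hypothesis (d_gt1 : (1 < d)%N).

(* The hypotheses on phi make the ideal proper, which MathComp's quotient
   rings, being nonzero by construction, require. *)
Definition dan_ideal : idealr {mpoly K[3]} :=
  HB.pack (principal_ideal (dan_equation f phi))
    (isIdealr.Build _ _ (dan_ideal_closed f phi_monic phi_size d_gt1)).

Definition danielewski : comAlgType K := {ideal_quot dan_ideal}.

Definition dan_x : danielewski := \pi_{ideal_quot dan_ideal} varX.

End Ring.

End Danielewski.

(* Main.v *)
Require Import Defs.
From HB Require Import structures.
From mathcomp Require Import all_boot all_order all_algebra.
From mathcomp Require Import generic_quotient ring_quotient fraction.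
From mathcomp Require Import boolp classical_sets.
From mathcomp Require Import mpoly.
From mathcomp Require Import ring zify.

Set Implicit Arguments.
Unset Strict Implicit.
Unset Printing Implicit Defensive.

Import GRing.Theory.
Local Open Scope ring_scope.
Local Open Scope quotient_scope.

(** Write B for the surface ring, generated by x, y, z with f(x) y = phi(x,z).

Inverting f(x) makes y = phi/f redundant, so every b in B satisfies
f(x)^N b = P(x,z) for some N and some polynomial P. Order the monomials
lexicographically, by the degree in z first and by the degree in x next,
where dividing by f^N lowers the degree in x by r N and may make it negative.
Each nonzero b then has a leading exponent (i, j), i natural and j an integer
([leading]); x, z and y have exponents (0, 1), (1, 0) and (d, -r). As phi is
monic of degree d in z, the relation phi = f y lets one write b as a
polynomial in y whose coefficients P_k(x,z) have degree less than d in z. The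
leading terms of the P_k y^k cannot cancel, whence j >= - r floor(i / d)
([leading_exists], [leading_bound]).

A derivation is D = D(x) d/dx + D(z) d/dz. On leading terms it therefore acts
as an Euler operator: it multiplies the coefficient at (i, j) by a linear form
al j + be i and shifts the exponent by a fixed vector e = (e1, e2)
([leading_der]). If D is locally nilpotent, the linear form must vanish
somewhere on the half-orbit (i, j) + k e of the exponent of each nonzero b
([nilpotent_weight]). Suppose that D(x) is nonzero. The vanishing for x, y and
z, in characteristic zero, forces e to lie strictly below the ray spanned by
the exponent of y, while D(x) and D(z) have leading exponents e + (0, 1) and
e + (1, 0), to which the bound above applies. For r > 1 and d > 1 there is no
such e ([no_exponent]), so D(x) = 0 ([lnd_x]).

Hence D = D(z) d/dz, and its kernel consists of the elements of degree 0 in z,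
that is of K[x] ([ker_sub_adjoin]). Conversely K[x] is annihilated by a nonzero
locally nilpotent derivation, f d/dz + phi_z d/dy ([vertical_lnd]).

The argument is carried out in any algebra A generated by elements x, y, z that
satisfy the relation and for which P(X,Z) |-> P(x,z) is injective. The last
part checks this for the quotient of K[X,Y,Z], where injectivity follows by
mapping Y to phi/f in the fraction field of K[X][Z]. *)

(** * Top coefficients of polynomials *)

Lemma coefM_top (R : nzSemiRingType) (p q : {poly R}) m n :
  (size p <= m.+1)%N -> (size q <= n.+1)%N ->
  (size (p * q)%R <= (m + n).+1)%N /\ (p * q)`_(m + n) = p`_m * q`_n.
Proof.
move=> sp sq; split.
  by apply: leq_trans (size_polyMleq _ _) _; lia.
have lt_m : (m < (m + n).+1)%N by lia.
rewrite coefM (bigD1 (Ordinal lt_m)) //= addKn big1 ?addr0 // => k.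
rewrite -val_eqE /= => km; case: (ltnP m k) => mk.
  by rewrite nth_default ?mul0r //; lia.
have lt_km : (k < m)%N by rewrite ltn_neqAle km.
by rewrite [q`_ _]nth_default ?mulr0 //; apply: (leq_trans sq); lia.
Qed.

Section LexTop.
Variable K : idomainType.
Implicit Types P Q : {poly {poly K}}.

(** Only an upper bound on the exponents of P is required, and c may be zero:
this makes the predicate additive and compatible with derivatives, whose top
coefficient can vanish. *)
Definition lextop P i m c :=
  [/\ (size P <= i.+1)%N, (size (P`_i)%R <= m.+1)%N & P`_i`_m = c].

Lemma lextopD P Q i m c c' :
  lextop P i m c -> lextop Q i m c' -> lextop (P + Q) i m (c + c').
Proof.
move=> [sP sPi <-] [sQ sQi <-]; split; last by rewrite !coefD.
  by apply: leq_trans (size_polyD _ _) _; rewrite geq_max sP.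
by rewrite coefD; apply: leq_trans (size_polyD _ _) _; rewrite geq_max sPi.
Qed.

Lemma lextopM P Q i i' m m' c c' : lextop P i m c -> lextop Q i' m' c' ->
  lextop (P * Q) (i + i') (m + m') (c * c').
Proof.
move=> [sP sPi <-] [sQ sQi <-].
have [sM cM] := coefM_top sP sQ; have [sM' cM'] := coefM_top sPi sQi.
by split; rewrite ?cM.
Qed.

Lemma lextopC (p : {poly K}) m : (size p <= m.+1)%N -> lextop p%:P 0 m p`_m.
Proof. by move=> sp; split; rewrite ?coefC //= size_polyC; case: eqP. Qed.

Lemma lextop_lead P : P != 0 ->
  lextop P (size P).-1 (size (lead_coef P)).-1 (lead_coef (lead_coef P)).
Proof. by move=> P0; split=> //; rewrite ?leqSpred. Qed.

Lemma lextop_derivx P i m c :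
  lextop P i m.+1 c -> lextop (map_poly (@deriv K) P) i m (c *+ m.+1).
Proof.
move=> [sP sPi <-].
have cE k : (map_poly (@deriv K) P)`_k = (P`_k)^`() by rewrite coef_map.
split; last by rewrite cE coef_deriv.
  by apply: leq_trans (size_poly _ _) _.
rewrite cE; case: (eqVneq P`_i 0) => [->|Pi0]; first by rewrite deriv0 size_poly0.
by rewrite -ltnS; apply: leq_trans sPi; apply: lt_size_deriv.
Qed.

Lemma lextop_derivz P i m c :
  lextop P i.+1 m c -> lextop P^`() i m (c *+ i.+1).
Proof.
move=> [sP sPi <-]; split; rewrite ?coef_deriv ?coefMn //.
  case: (eqVneq P 0) => [->|P0]; first by rewrite deriv0 size_poly0.
  by rewrite -ltnS; apply: leq_trans sP; apply: lt_size_deriv.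
apply: leq_trans sPi; rewrite -scaler_nat; exact: size_scale_leq.
Qed.

End LexTop.

(** * Leading exponents in the surface ring *)

Section Surface.
Variables (K : fieldType) (r d : nat) (f : {poly K}) (phi : {poly {poly K}}).
Hypotheses (charK0 : [pchar K] =i pred0).
Hypotheses (r_gt1 : (1 < r)%N) (d_gt1 : (1 < d)%N).
Hypotheses (f_monic : f \is monic) (f_size : size f = r.+1).
Hypotheses (phi_monic : phi \is monic) (phi_size : size phi = d.+1).
Variables (A : comAlgType K) (x y z : A).

Lemma natK_eq0 (n : nat) : ((n%:R : K) == 0) = (n == 0%N).
Proof. by move/pcharf0P: charK0 => ->. Qed.

Lemma intK_eq0 (n : int) : ((n%:~R : K) == 0) = (n == 0).
Proof. by case: n => n; rewrite ?NegzE ?mulrNz ?oppr_eq0 natK_eq0. Qed.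

Lemma evxz_comm : commr_rmorph (horner_alg x) z.
Proof. by move=> a; apply: mulrC. Qed.

Definition evxz := horner_morph evxz_comm.
HB.instance Definition _ := GRing.RMorphism.on evxz.

Lemma evxzC p : evxz p%:P = horner_alg x p.
Proof. exact: horner_morphC. Qed.

Lemma evxzX : evxz 'X = z.
Proof. exact: horner_morphX. Qed.

Hypothesis relation : horner_alg x f * y = evxz phi.
Hypothesis evxz_inj : injective evxz.
Hypothesis generated : forall b : A,
  exists Q : {poly {poly {poly K}}}, b = (map_poly evxz Q).[y].

Local Notation fx := (horner_alg x f).

Lemma lextop_fexp k : lextop (f ^+ k)%:P 0 (r * k) 1.
Proof.
have fk_monic : f ^+ k \is monic by rewrite monic_exp.
have sf : size (f ^+ k)%R = (r * k).+1.
  have := size_exp f k; rewrite f_size /= => <-.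
  by rewrite prednK // size_poly_gt0 monic_neq0.
have <- : (f ^+ k)`_(r * k) = 1.
  by rewrite -[RHS](monicP fk_monic) lead_coefE sf.
by apply: lextopC; rewrite sf.
Qed.

(** The leading term of b is at most c z^i x^j for the lexicographic order in
which z dominates; it is read off from P = f^N b, where the x-degree is larger
by r N. Here c may be zero, as in [lextop]; (i, j) is the leading exponent of
b exactly when c is nonzero. *)
Definition leading (b : A) (i : nat) (j : int) (c : K) := exists N m P,
  [/\ fx ^+ N * b = evxz P, m%:Z = j + (r * N)%:Z & lextop P i m c].

(** The power of f that clears denominators can be taken as large as needed. *)
Lemma leading_raise b i j c k : leading b i j c -> exists N m P,
  [/\ fx ^+ N * b = evxz P, m%:Z = j + (r * N)%:Z, lextop P i m c & (k <= N)%N].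
Proof.
move=> [N [m [P [bP mE tP]]]].
exists (k + N)%N, (r * k + m)%N, ((f ^+ k)%:P * P); split; last by lia.
- by rewrite rmorphM /= evxzC rmorphXn /= exprD -mulrA bP.
- by rewrite mulnDr !PoszD mE; lia.
- by have := lextopM (lextop_fexp k) tP; rewrite add0n mul1r.
Qed.

Lemma leading_poly P i m c : lextop P i m c -> leading (evxz P) i m c.
Proof. by move=> tP; exists 0%N, m, P; rewrite mul1r muln0 addr0. Qed.

Lemma leading_divf N b i j c :
  leading (fx ^+ N * b) i (j + (r * N)%:Z) c -> leading b i j c.
Proof.
move=> [M [m [P [bP mE tP]]]]; exists (M + N)%N, m, P; split=> //.
  by rewrite exprD -mulrA.
by rewrite mE mulnDr PoszD; lia.
Qed.

Lemma leading0 i j : leading 0 i j 0.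
Proof.
exists (absz j), (absz (j + (r * absz j)%:Z)), 0; split; rewrite ?mulr0 ?rmorph0 //.
  by rewrite gez0_abs //; nia.
by split; rewrite ?coef0 ?size_poly0.
Qed.

Lemma leadingM b b' i i' j j' c c' : leading b i j c -> leading b' i' j' c' ->
  leading (b * b') (i + i') (j + j') (c * c').
Proof.
move=> [N [m [P [bP mE tP]]]] [N' [m' [P' [bP' mE' tP']]]].
exists (N + N')%N, (m + m')%N, (P * P'); split; last exact: lextopM.
  by rewrite rmorphM /= -bP -bP' exprD mulrACA.
by rewrite PoszD mE mE' mulnDr PoszD addrACA.
Qed.

Lemma leadingD b b' i j c c' : leading b i j c -> leading b' i j c' ->
  leading (b + b') i j (c + c').
Proof.
move=> [N [m [P [bP mE tP]]]] [N' [m' [P' [bP' mE' tP']]]].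
exists (N + N')%N, (m + r * N')%N, ((f ^+ N')%:P * P + (f ^+ N)%:P * P'); split.
- rewrite rmorphD !rmorphM /= !evxzC !rmorphXn /= -bP -bP' mulrDr exprD.
  by congr (_ + _); rewrite !mulrA // [fx ^+ N' * _]mulrC.
- by rewrite PoszD mE mulnDr PoszD addrA.
- apply: lextopD.
    by rewrite addnC; have := lextopM (lextop_fexp N') tP; rewrite mul1r add0n.
  have -> : (m + r * N' = r * N + m')%N by lia.
  by have := lextopM (lextop_fexp N) tP'; rewrite mul1r.
Qed.

Lemma leading_opp b i j c : leading b i j c -> leading (- b) i j (- c).
Proof.
have s1 : (size (-1 : {poly K})%R <= 1)%N by rewrite size_polyN size_poly1.
have := leading_poly (lextopC s1); rewrite coefN coef1 => l1.
by move/(leadingM l1); rewrite add0r evxzC rmorphN1 !mulN1r.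
Qed.

Lemma leading_mono b i j c i' j' : leading b i j c ->
  (i < i')%N \/ (i = i' /\ j < j') -> leading b i' j' 0.
Proof.
move=> /(leading_raise (absz j'))[N [m [P [bP mE [sP sPi _] leN]]]] ii'.
exists N, (absz (j' + (r * N)%:Z)), P; split=> //; first by rewrite gez0_abs //; nia.
case: ii' => [lti | [<- ltj]].
  have Pi0 : P`_i' = 0 by rewrite nth_default //; apply: (leq_trans sP); lia.
  by split; rewrite ?Pi0 ?coef0 ?size_poly0 //; apply: leq_trans sP _; lia.
have ltm : (m < absz (j' + (r * N)%:Z)%R)%N by lia.
split=> //; first by apply: leq_trans sPi _; lia.
by rewrite nth_default //; apply: leq_trans sPi _; lia.
Qed.

Lemma leading_coef_uniq b i j c c' :
  leading b i j c -> leading b i j c' -> c = c'.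
Proof.
move=> bc /leading_opp bc'; apply/eqP; rewrite -subr_eq0; apply/eqP.
have [N [m [P [bP mE [_ _ <-]]]]] := leadingD bc bc'.
suff -> : P = 0 by rewrite !coef0.
by apply: evxz_inj; rewrite -bP subrr mulr0 rmorph0.
Qed.

Lemma leading_uniq b i j c i' j' c' : leading b i j c -> c != 0 ->
  leading b i' j' c' -> c' != 0 -> i = i' /\ j = j'.
Proof.
move=> bc c0 bc' c0'.
have no (k k' : nat) (l l' : int) (e e' : K) : leading b k l e ->
    leading b k' l' e' -> e' != 0 -> ~ ((k < k')%N \/ (k = k' /\ l < l')).
  move=> be be' e0 /(leading_mono be) be0.
  by rewrite (leading_coef_uniq be' be0) eqxx in e0.
have := no _ _ _ _ _ _ bc bc' c0'; have := no _ _ _ _ _ _ bc' bc c0.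
by lia.
Qed.

Lemma leading_y k : leading (y ^+ k) (d * k) (- (r * k)%:Z) 1.
Proof.
elim: k => [|k IH].
  rewrite muln0 muln0 expr0 -(rmorph1 evxz) oppr0.
  apply: leading_poly; split; rewrite ?size_polyC ?coefC ?oner_eq0 ?eqxx //=.
  by rewrite size_poly1.
have ly : leading y d (- r%:Z) 1.
  exists 1%N, 0%N, phi; split=> //; first by rewrite muln1 addNr.
  have -> : 1 = (phi`_d)`_0.
    by have /monicP := phi_monic; rewrite lead_coefE phi_size /= => ->; rewrite coefC.
  split=> //; first by rewrite phi_size.
  by have /monicP := phi_monic; rewrite lead_coefE phi_size /= => ->; rewrite size_poly1.
have := leadingM ly IH; rewrite -exprS mul1r.
by congr (leading _ _ _ _); lia.
Qed.

Lemma leading_ne0 b i j c : leading b i j c -> c != 0 -> b != 0.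
Proof.
move=> bc; apply: contraNneq => b0; rewrite b0 in bc.
by rewrite (leading_coef_uniq bc (leading0 i j)).
Qed.

Lemma fx_exp_neq0 N : fx ^+ N != 0.
Proof.
rewrite -rmorphXn /= -evxzC.
exact: leading_ne0 (leading_poly (lextop_fexp N)) (oner_neq0 K).
Qed.

(** * Normal forms and the cone of exponents *)

Definition evy (Q : {poly {poly {poly K}}}) := (map_poly evxz Q).[y].
Definition normal b := exists Q : {poly {poly {poly K}}},
  (forall k, (size (Q`_k)%R <= d)%N) /\ b = evy Q.

Lemma evyD P Q : evy (P + Q) = evy P + evy Q.
Proof. by rewrite /evy rmorphD hornerD. Qed.

Lemma normalD b b' : normal b -> normal b' -> normal (b + b').
Proof.
move=> [Q [sQ ->]] [Q' [sQ' ->]]; exists (Q + Q'); split; last by rewrite evyD.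
by move=> k; rewrite coefD; apply: leq_trans (size_polyD _ _) _; rewrite geq_max sQ sQ'.
Qed.

Lemma normal_small (P : {poly {poly K}}) k : (size P <= d)%N -> normal (evxz P * y ^+ k).
Proof.
move=> sP; exists (P%:P * 'X^k); split.
  by move=> l; rewrite coefCM coefXn; case: eqP; rewrite ?mulr1 ?mulr0 ?size_poly0.
by rewrite /evy rmorphM /= map_polyC map_polyXn hornerM hornerC hornerXn.
Qed.

(** Induction on the degree in z: dividing P by the monic phi = f y trades each
multiple of phi for a power of y and lowers the degree. *)
Lemma normal_monomial (P : {poly {poly K}}) k : normal (evxz P * y ^+ k).
Proof.
have [n] := ubnP (size P); elim: n P k => // n IH P k /ltnSE sP.
case: (leqP (size P) d) => [|ltd]; first exact: normal_small.
pose Q := P %/ phi; pose R := P %% phi.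
have PE : P = Q * phi + R by apply: Pdiv.IdomainMonic.divp_eq.
rewrite PE rmorphD rmorphM /= -relation mulrDl; apply: normalD.
  have -> : evxz Q * (fx * y) * y ^+ k = evxz (Q * f%:P) * y ^+ k.+1.
    by rewrite rmorphM /= evxzC exprS; ring.
  apply: IH; apply: leq_trans sP; apply: leq_ltn_trans (size_polyMleq _ _) _.
  have -> : size (f%:P : {poly {poly K}}) = 1%N by rewrite size_polyC monic_neq0.
  by rewrite addn1 /= Pdiv.CommonIdomain.size_divp ?monic_neq0 // phi_size ltn_subrL
    (ltnW d_gt1) (leq_ltn_trans _ ltd).
apply: normal_small; rewrite -ltnS -phi_size.
by apply: Pdiv.CommonIdomain.ltn_modpN0; rewrite monic_neq0.
Qed.

Lemma normal_all b : normal b.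
Proof.
have [Q ->] := generated b; rewrite horner_coef.
apply: (big_ind normal) => [||k _]; last by rewrite coef_map; apply: normal_monomial.
  by exists 0; split=> [k|]; rewrite ?coef0 ?size_poly0 // /evy rmorph0 horner0.
exact: normalD.
Qed.

(** In a normal form the term P_k y^k has degree in z between d k and d k + d - 1,
so the term of highest k contains the leading term: k = i / d, and the exponent
of x is at least - r k. When i = 0, that term is all of b. *)
Lemma leading_exists b : b != 0 -> exists i j c,
  [/\ leading b i j c, c != 0, - (r * (i %/ d))%:Z <= j &
      i = 0%N -> exists g, b = horner_alg x g].
Proof.
have [Q [sQ bE]] := normal_all b => b0.
have Q0 : Q != 0 by apply: contraNneq b0 => Q0; rewrite bE Q0 /evy rmorph0 horner0.
pose n := (size Q).-1; pose q := lead_coef Q.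
have sQE : size Q = n.+1 by rewrite /n prednK // size_poly_gt0.
have q0 : q != 0 by rewrite lead_coef_eq0.
have sq : (size q <= d)%N by apply: sQ.
have {}bE : b = \sum_(k < n) evxz Q`_k * y ^+ k + evxz q * y ^+ n.
  have sM : (size (map_poly evxz Q) <= n.+1)%N by rewrite -sQE size_poly.
  rewrite bE /evy (horner_coef_wide _ sM) big_ord_recr /= coef_map.
  by rewrite /q lead_coefE sQE; congr (_ + _); apply: eq_bigr => k _; rewrite coef_map.
pose i := ((size q).-1 + d * n)%N.
pose j := (size (lead_coef q)).-1%:Z - (r * n)%:Z.
have i_div : (i %/ d)%N = n.
  rewrite /i addnC mulnC divnMDl; last by lia.
  have := size_poly_gt0 q; rewrite q0 => sq0.
  by rewrite divn_small ?addn0 //; apply: leq_trans sq; rewrite prednK.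
exists i, j, (lead_coef (lead_coef q)); split.
- rewrite bE -[lead_coef (lead_coef q)]add0r; apply: leadingD; last first.
    by have := leadingM (leading_poly (lextop_lead q0)) (leading_y n); rewrite mulr1.
  apply: (big_ind (fun a => leading a i j 0)); first exact: leading0.
    by move=> a a' la la'; rewrite -[0]addr0; apply: leadingD.
  move=> k _; case: (eqVneq Q`_k 0) => [->|Qk0].
    by rewrite rmorph0 mul0r; apply: leading0.
  have lk := leadingM (leading_poly (lextop_lead Qk0)) (leading_y k).
  apply: (leading_mono lk); left; rewrite /i.
  apply: (@leq_trans (d * n)); last exact: leq_addl.
  apply: (@leq_trans (d * k.+1)); last by rewrite leq_pmul2l //; lia.
  by rewrite mulnS ltn_add2r prednK ?size_poly_gt0.
- by rewrite !lead_coef_eq0.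
- by rewrite i_div /j; lia.
- move=> i0; have n0 : n = 0%N by rewrite -i_div i0 div0n.
  have sq1 : (size q <= 1)%N by move: i0; rewrite /i; case: (size q) => [|[|s]] //=; lia.
  exists q`_0; rewrite bE n0 big_ord0 add0r mulr1 -evxzC; congr evxz.
  exact: size1_polyC.
Qed.

Lemma leading_bound b i j c :
  leading b i j c -> c != 0 -> - (r * (i %/ d))%:Z <= j.
Proof.
move=> bc c0; have [i' [j' [c' [bc' c0' le_j _]]]] := leading_exists (leading_ne0 bc c0).
by have [-> ->] := leading_uniq bc c0 bc' c0'.
Qed.

(** There are no zero divisors, since leading coefficients multiply. *)
Lemma surface_mulf_eq0 (b b' : A) : b * b' = 0 -> b != 0 -> b' = 0.
Proof.
move=> bb' b0; apply: contra_eq (bb') => b0'.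
have [i [j [c [bc c0 _ _]]]] := leading_exists b0.
have [i' [j' [c' [bc' c0' _ _]]]] := leading_exists b0'.
by apply: (leading_ne0 (leadingM bc bc')); rewrite mulf_neq0.
Qed.

(** * The action of a derivation on leading terms *)

Section Derivation.
Variable D : {linear A -> A}.
Hypothesis derD : forall a b : A, D (a * b) = D a * b + a * D b.

Lemma der1 : D 1 = 0.
Proof. by apply: (addrI (D 1)); rewrite addr0 -{3}[1]mulr1 derD mulr1 mul1r. Qed.

Lemma der_adjoin p : D (horner_alg x p) = horner_alg x p^`() * D x.
Proof.
elim/poly_ind: p => [|p c IH]; first by rewrite deriv0 !rmorph0 linear0 mul0r.
rewrite rmorphD rmorphM /= horner_algX horner_algC linearD derD linearZ /= der1.
rewrite scaler0 addr0 derivMXaddC rmorphD rmorphM /= horner_algX IH; ring.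
Qed.

Lemma der_evxz P : D (evxz P) =
  evxz (map_poly (@deriv K) P) * D x + evxz P^`() * D z.
Proof.
elim/poly_ind: P => [|P c IH].
  by rewrite map_poly0 deriv0 !rmorph0 linear0 !mul0r addr0.
have -> : map_poly (@deriv K) (P * 'X + c%:P)
    = map_poly (@deriv K) P * 'X + (c^`())%:P.
  apply/polyP=> k; rewrite coef_map !coefD !coefMX !coefC coef_map /= derivD.
  by case: k => [|k] /=; rewrite ?deriv0.
rewrite !rmorphD !rmorphM /= !evxzX !evxzC linearD derD der_adjoin derivMXaddC.
rewrite rmorphD rmorphM /= evxzX IH; ring.
Qed.

Lemma der_exp b n : D (b ^+ n) = (b ^+ n.-1 * D b) *+ n.
Proof.
elim: n => [|n IH]; first by rewrite der1 mulr0n.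
rewrite exprS derD IH mulrnAr mulrA -exprS mulrC mulrS /=.
by case: n {IH} => [|n]; rewrite ?mulr0n //= mulrC.
Qed.

(** The heart of the argument. From f^N b = P one gets
f^(N+1) D(b) = f (P_x D(x) + P_z D(z)) - N f' D(x) P; with m = j + r N, the
three terms contribute m al c, i be c and - r N al c to the coefficient, and
m - r N = j. The degree e1 is a natural number because the case of interest
is D(x) nonzero, where e1 is at least the degree of D(x) in z. *)
Lemma leading_der (e1 : nat) (e2 : int) (al be : K) b i j c :
  leading (D x) e1 (e2 + 1) al -> leading (D z) e1.+1 e2 be -> leading b i j c ->
  leading (D b) (i + e1) (j + e2) ((al * j%:~R + be * i%:R) * c).
Proof.
move=> lA lC /(leading_raise (absz j).+1) [N' [m' [P [bP mE tP leN]]]].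
have [N NE] : exists N, N' = N.+1 by exists N'.-1; lia.
rewrite {}NE in bP mE leN.
(* A positive degree in x keeps m - 1 meaningful for the x-derivative. *)
have [m m'E] : exists m, m' = m.+1 by exists m'.-1; nia.
rewrite {}m'E in mE tP; apply: (@leading_divf N.+2).
have -> : fx ^+ N.+2 * D b = fx * (evxz (map_poly (@deriv K) P) * D x)
    + fx * (evxz P^`() * D z) - horner_alg x (f^`() *+ N.+1) * D x * evxz P.
  have := der_evxz P; rewrite -[in LHS]bP derD (der_exp fx N.+1) der_adjoin /=.
  move=> /(canRL (addKr _)) DbE; rewrite [fx ^+ N.+2]exprS -mulrA DbE -bP.
  rewrite rmorphMn /= -[X in X * b]mulr_natr -[X in X * D x * _]mulr_natr exprS.
  by move: (N.+1%:R : A) (fx ^+ N) fx (horner_alg x f^`()) => n u v w; ring.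
have lf : leading fx 0 r 1.
  by have := leading_poly (lextop_fexp 1); rewrite expr1 evxzC muln1.
have lf' : leading (horner_alg x (f^`() *+ N.+1)) 0 r.-1 (r * N.+1)%:R.
  have sf' : (size (f^`() *+ N.+1)%R <= r.-1.+1)%N.
    rewrite prednK; last by lia.
    rewrite -scaler_nat; apply: leq_trans (size_scale_leq _ _) _.
    by rewrite -ltnS -f_size lt_size_deriv // monic_neq0.
  have := leading_poly (lextopC sf'); rewrite evxzC coefMn coef_deriv prednK; last by lia.
  by rewrite -mulrnA; have /monicP := f_monic; rewrite lead_coefE f_size /= => ->.
have jE : j%:~R = m.+1%:R - (r * N.+1)%:R :> K.
  by rewrite -[m.+1%:R]/((m.+1%:Z)%:~R) mE rmorphD /= addrK.
have l1 := leadingM lf (leadingM (leading_poly (lextop_derivx tP)) lA).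
have l3 := leading_opp (leadingM (leadingM lf' lA) (leading_poly tP)).
have l2 : leading (fx * (evxz P^`() * D z)) (i + e1)
    (r%:Z + (m.+1%:Z + e2)) (be * i%:R * c).
  (* For i = 0, be i c vanishes and so does the z-derivative of P. *)
  case: i tP {l1 l3} => [|i] tP.
    have -> : P^`() = 0.
      by case: tP => sP _ _; rewrite (size1_polyC sP) derivC.
    by rewrite rmorph0 mul0r !mulr0 mul0r; apply: leading0.
  have := leadingM lf (leadingM (leading_poly (lextop_derivz tP)) lC).
  by congr (leading _ _ _ _); [lia | rewrite -[c *+ _]mulr_natr; ring].
have -> : j + e2 + (r * N.+2)%:Z = r%:Z + (m.+1%:Z + e2) by rewrite mE; lia.
have -> : (al * j%:~R + be * i%:R) * c
  = 1 * ((c *+ m.+1) * al) + be * i%:R * c + - ((r * N.+1)%:R * al * c).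
  by rewrite jE -[c *+ _]mulr_natr; ring.
apply: leadingD; first apply: leadingD => //.
  by move: l1; congr (leading _ _ _ _); lia.
by move: l3; congr (leading _ _ _ _); lia.
Qed.

Lemma leading_iter (e1 : nat) (e2 : int) (al be : K) b i j c n :
  leading (D x) e1 (e2 + 1) al -> leading (D z) e1.+1 e2 be -> leading b i j c ->
  leading (iter n D b) (i + n * e1) (j + n%:Z * e2)
    (\prod_(k < n) (al * (j + k%:Z * e2)%:~R + be * (i + k * e1)%:R) * c).
Proof.
move=> lA lC lb; elim: n => [|n IH]; first by rewrite big_ord0 mul1r mul0r addr0 addn0.
have := leading_der lA lC IH; rewrite iterS big_ord_recr /=.
congr (leading _ _ _ _).
- by rewrite mulSnr addnA.
- by rewrite -addn1 PoszD mulrDl mul1r addrA.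
- by rewrite mulrA [X in X * c]mulrC.
Qed.

(** The coefficient of the k-th iterate is a product of weights, which must
vanish as soon as the iterate does. *)
Lemma nilpotent_weight (e1 : nat) (e2 : int) (al be : K) b i j c n :
  leading (D x) e1 (e2 + 1) al -> leading (D z) e1.+1 e2 be ->
  leading b i j c -> c != 0 -> iter n D b = 0 ->
  exists k : nat, al * (j + k%:Z * e2)%:~R + be * (i + k * e1)%:R = 0.
Proof.
move=> lA lC lb c0 bn; have := leading_iter n lA lC lb; rewrite bn => l0.
have /eqP := leading_coef_uniq l0 (leading0 _ _).
by rewrite mulf_eq0 (negPf c0) orbF prodf_seq_eq0 => /hasP[k _ /eqP]; exists k.
Qed.

(** The shift (e1, e2) is the larger of the shifts produced by D(x) d/dx and by
D(z) d/dz. *)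
Lemma der_degree : D x != 0 -> exists (e1 : nat) (e2 : int) (al be : K),
  [/\ leading (D x) e1 (e2 + 1) al, leading (D z) e1.+1 e2 be
    & al != 0 \/ be != 0].
Proof.
move=> /leading_exists[a1 [a2 [a [la a0 _ _]]]].
have la' : leading (D x) a1 (a2 - 1 + 1) a by rewrite subrK.
have dom : leading (D z) a1.+1 (a2 - 1) 0 -> exists (e1 : nat) (e2 : int) (al be : K),
    [/\ leading (D x) e1 (e2 + 1) al, leading (D z) e1.+1 e2 be & al != 0 \/ be != 0].
  by move=> l0; exists a1, (a2 - 1), a, 0; split=> //; left.
have [Dz0 | /leading_exists[c1 [c2 [c [lc c0 _ _]]]]] := eqVneq (D z) 0.
  by apply: dom; rewrite Dz0; apply: leading0.
have [lt_c|[[c1E c2E]|lt_a]] : ((c1 < a1.+1)%N \/ (c1 = a1.+1 /\ c2 < a2 - 1)) \/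
   ((c1 = a1.+1 /\ c2 = a2 - 1) \/
   ((0 < c1)%N /\ ((a1 < c1.-1)%N \/ (a1 = c1.-1 /\ a2 < c2 + 1)))) by lia.
- by apply: dom; apply: leading_mono lc lt_c.
- by exists a1, (a2 - 1), a, c; split; [|rewrite -c1E -c2E|left].
- case: lt_a => c1_gt0 lt_a; exists c1.-1, c2, 0, c; split; last by right.
    exact: leading_mono la lt_a.
  by rewrite prednK.
Qed.

(** The two equations put (e1, e2) strictly below the ray of (d, -r), that is
- d e2 > r e1. Write q for the integer part of e1 / d. Unless d divides e1 + 1,
the bound at e1 + 1 gives - d e2 <= r d q <= r e1. If d divides e1 + 1, then
e1 = d q + d - 1 and the bound at e1 gives - d e2 <= d + r d q, which is at
most r e1 because d <= r (d - 1) when r and d exceed 1. *)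
Lemma no_exponent (k1 k2 k3 e1 : nat) (e2 : int) :
  k1%:Z * e2 + k2%:Z * e1%:Z = - 1 -> d%:Z * k2%:Z - r%:Z * k1%:Z = k3%:Z ->
  - (r * (e1 %/ d))%:Z <= e2 + 1 -> - (r * (e1.+1 %/ d))%:Z <= e2 -> False.
Proof.
move=> he hy hA hC.
(* Multiply he by d and use r k1 <= d k2, which is hy. *)
have steep : d%:Z * e2 < - (r%:Z * e1%:Z) by nia.
have := divn_eq e1 d; have := ltn_pmod e1 (ltnW d_gt1).
set q := (e1 %/ d)%N in hA *; set s := (e1 %% d)%N => lts e1E.
have [lts1|] := ltnP s.+1 d.
  have : (e1.+1 %/ d = q)%N by rewrite e1E -addnS divnMDl ?divn_small ?addn0 //; lia.
  by move=> qE; rewrite qE in hC; nia.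
move=> ges; have sE : s = d.-1 by lia.
rewrite sE in e1E.
nia.
Qed.

(** * Locally nilpotent derivations *)

Hypothesis nilD : forall b, exists n, iter n D b = 0.

(** Let - w be the weight lost at each step. The weights al, be and d be - r al
of x, z and y are natural multiples k1, k2, k3 of it, and the definition of w
becomes k1 e2 + k2 e1 = -1. *)
Lemma lnd_x : D x = 0.
Proof.
apply/eqP/negPn/negP => /der_degree[e1 [e2 [al [be [lA lC ab0]]]]].
have lx : leading x 0 1 1.
  have := leading_poly (@lextopC K 'X 1 _); rewrite size_polyX evxzC horner_algX coefX.
  exact.
have lz : leading z 1 0 1.
  rewrite -evxzX; apply: leading_poly.
  by split; rewrite ?size_polyX ?coefX ?size_poly1 ?coef1.
have ly := leading_y 1; rewrite expr1 !muln1 in ly.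
have n10 : 1 != 0 :> K := oner_neq0 K.
pose w := al * e2%:~R + be * e1%:R.
have weight k i j : al * (j + k%:Z * e2)%:~R + be * (i + k * e1)%:R
    = (al * j%:~R + be * i%:R) + k%:R * w.
  by rewrite rmorphD rmorphM natrD natrM /= /w pmulrn; ring.
have wE : al * e2%:~R + be * e1%:R = w by [].
clearbody w.
have [n1 /(nilpotent_weight lA lC lx n10)[k1]] := nilD x.
rewrite weight mulr1 mulr0 addr0 => e_x.
have [n2 /(nilpotent_weight lA lC lz n10)[k2]] := nilD z.
rewrite weight mulr1 mulr0 add0r => e_z.
have [n3 /(nilpotent_weight lA lC ly n10)[k3]] := nilD y.
rewrite weight => e_y.
have alE : al = k1%:R * - w by rewrite mulrN; apply/eqP; rewrite -addr_eq0 e_x.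
have beE : be = k2%:R * - w by rewrite mulrN; apply/eqP; rewrite -addr_eq0 e_z.
have w0 : w != 0.
  apply: contraPneq ab0 => w0; rewrite alE beE w0 oppr0 !mulr0 eqxx.
  by case.
have he : k1%:Z * e2 + k2%:Z * e1%:Z = - 1.
  apply/eqP; rewrite -addr_eq0 -intK_eq0 -(mulIr_eq0 _ (mulIf w0)).
  rewrite -[X in _ == X](subrr w) -{3}wE {1}alE {1}beE.
  by apply/eqP; rewrite rmorphD rmorphD !rmorphM /=; ring.
have hy : d%:Z * k2%:Z - r%:Z * k1%:Z = k3%:Z.
  apply/eqP; rewrite eq_sym -subr_eq0 -intK_eq0 -(mulIr_eq0 _ (mulIf w0)).
  rewrite -e_y alE beE rmorphN; apply/eqP.
  by rewrite !rmorphB !rmorphM /=; ring.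
have al0 : al != 0.
  rewrite alE mulf_neq0 ?oppr_eq0 // natK_eq0; apply: contra_eqN he => /eqP k10.
  by rewrite k10 mul0r add0r; nia.
have k1_gt0 : (0 < k1)%N.
  by rewrite lt0n -natK_eq0; apply: contraNneq al0 => k10; rewrite alE k10 mul0r.
have be0 : be != 0.
  rewrite beE mulf_neq0 ?oppr_eq0 // natK_eq0; nia.
exact: no_exponent he hy (leading_bound lA al0) (leading_bound lC be0).
Qed.

(** With D(x) = 0, f^N D(p) = P_z D(z); so D(p) = 0 forces P_z = 0, that is a
leading exponent with i = 0. *)
Lemma ker_sub_adjoin p : (exists a, D a != 0) -> D p = 0 ->
  exists g, p = horner_alg x g.
Proof.
move=> [a Da0] Dp0; have Dx := lnd_x.
have DE b N P : fx ^+ N * b = evxz P -> fx ^+ N * D b = evxz P^`() * D z.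
  move=> bP; have := der_evxz P; rewrite Dx mulr0 add0r -bP derD der_exp.
  by rewrite der_adjoin Dx !mulr0 mul0rn mul0r add0r.
have Dz0 : D z != 0.
  apply: contraNneq Da0 => Dz0; have [a0|a0] := eqVneq a 0; first by rewrite a0 linear0.
  have [i [j [c [[N [m [P [aP _ _]]]] _ _ _]]]] := leading_exists a0.
  by apply/eqP/(surface_mulf_eq0 _ (fx_exp_neq0 N)); rewrite (DE _ _ _ aP) Dz0 mulr0.
have [p0|p0] := eqVneq p 0; first by exists 0; rewrite rmorph0.
have [i [j [c [[N [m [P [pP _ [sP sPi cE]]]]] c0 _]]]] := leading_exists p0; apply.
have P'0 : P^`() = 0.
  apply: evxz_inj; rewrite rmorph0; apply: (surface_mulf_eq0 _ Dz0).
  by rewrite mulrC -(DE _ _ _ pP) Dp0 mulr0.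
case: i sP sPi cE => // i _ _ cE; case/eqP: c0; rewrite -cE.
have /polyP/(_ i) := P'0; rewrite coef_deriv coef0 => /polyP/(_ m).
rewrite coefMn coef0 => /eqP; rewrite -mulr_natr mulf_eq0 natK_eq0 orbF.
by move/eqP.
Qed.

End Derivation.

(** Such a D maps f^N b = P(x,z) to f P_z, so it lowers the degree of P in z. *)
Lemma vertical_lnd (D : {linear A -> A}) : is_derivation D ->
  D x = 0 -> D z = fx -> nonzero_LND D.
Proof.
move=> derD Dx Dz.
split=> //; last by exists z; rewrite Dz -[fx]expr1 fx_exp_neq0.
move=> b; have [b0|b0] := eqVneq b 0; first by exists 0%N.
have [i [j [c [[N [m [P [bP _ _]]]] _ _ _]]]] := leading_exists b0.
exists (size P); apply: (surface_mulf_eq0 _ (fx_exp_neq0 N)).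
have DfN k a : D (fx ^+ k * a) = fx ^+ k * D a.
  by rewrite derD (der_exp derD) (der_adjoin derD) Dx !mulr0 mul0rn mul0r add0r.
have DE n : fx ^+ N * iter n D b = fx ^+ n * evxz P^`(n).
  elim: n => [|n IH]; first by rewrite mul1r derivn0.
  rewrite iterS -DfN IH DfN (der_evxz derD) Dx mulr0 add0r Dz derivnS exprSr; ring.
by rewrite DE derivn_poly0 // rmorph0 mulr0.
Qed.

Lemma adjoin_subalg (a : A) : GRing.subalg_closed (mem (adjoin a)).
Proof.
split.
- by apply/mem_set; exists 1 => //; rewrite rmorph1.
- move=> k u v /set_mem[g _ <-] /set_mem[h _ <-]; apply/mem_set.
  by exists (k%:P * g + h) => //; rewrite rmorphD rmorphM /= horner_algC mulr_algl.
- move=> u v /set_mem[g _ <-] /set_mem[h _ <-]; apply/mem_set.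
  by exists (g * h) => //; rewrite rmorphM.
Qed.

Theorem surface_derksen (D : {linear A -> A}) : is_derivation D ->
  D x = 0 -> D z = fx -> derksen_invariant A = adjoin x.
Proof.
move=> derD Dx Dz; apply/seteqP; split=> b.
  apply; split; first exact: adjoin_subalg.
  move=> p [E [derE nilE E0] Ep].
  by have [g ->] := ker_sub_adjoin derE nilE E0 Ep; exists g.
move=> [g _ <-] S [_ subS]; apply: subS; exists D; first exact: vertical_lnd.
by rewrite /= (der_adjoin derD) Dx mulr0.
Qed.

End Surface.

(** * The coordinate ring *)

Local Notation "p %:F" := (@tofrac _ p).

Lemma bipoly_morph_ext (K : fieldType) (S : nzRingType)
    (g h : {rmorphism {poly {poly K}} -> S}) :
  (forall c, g c%:P%:P = h c%:P%:P) -> g 'X%:P = h 'X%:P -> g 'X = h 'X ->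
  g =1 h.
Proof.
move=> ghC ghX ghZ; elim/poly_ind => [|P p IH]; first by rewrite !rmorph0.
rewrite !rmorphD !rmorphM /= ghZ IH; congr (_ + _).
elim/poly_ind: p => [|p c IHp]; first by rewrite !rmorph0.
by rewrite polyCD polyCM !rmorphD !rmorphM /= ghX IHp ghC.
Qed.

Lemma mpoly_morph_ext (R : comNzRingType) n (S : nzRingType)
    (g h : {rmorphism {mpoly R[n]} -> S}) :
  (forall c, g c%:MP = h c%:MP) -> (forall i, g 'X_i = h 'X_i) -> g =1 h.
Proof.
move=> ghC ghX p; rewrite (mpolyE p) !rmorph_sum; apply: eq_bigr => m _.
rewrite -mul_mpolyC mpolyXE_id !rmorphM ghC !rmorph_prod; congr (_ * _).
by apply: eq_bigr => i _; rewrite !rmorphXn ghX.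
Qed.

Lemma evxz_morph (K : fieldType) (A B : comAlgType K) (g : {rmorphism A -> B})
    (x z : A) : (forall c : K, g c%:A = c%:A) ->
  forall P, g (evxz x z P) = evxz (g x) (g z) P.
Proof.
move=> gA; apply: (bipoly_morph_ext (g := g \o evxz x z) (h := evxz (g x) (g z)))
  => [c||] /=.
- by rewrite !evxzC !horner_algC.
- by rewrite !evxzC !horner_algX.
- by rewrite !evxzX.
Qed.

Lemma ord3_cases (i : 'I_3) : [\/ i = inord 0, i = inord 1 | i = inord 2].
Proof.
by case: i => [[|[|[|//]]] lti]; [apply: Or31 | apply: Or32 | apply: Or33];
  apply: val_inj; rewrite /= inordK.
Qed.

Lemma inord3_eq (j k : nat) : (j < 3)%N -> (k < 3)%N ->
  (inord j == inord k :> 'I_3) = (j == k).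
Proof. by move=> lt_j lt_k; rewrite -val_eqE /= !inordK. Qed.

Section Danielewski.
Variables (K : fieldType) (f : {poly K}) (phi : {poly {poly K}}) (d : nat).
Hypotheses (phi_monic : phi \is monic) (phi_size : size phi = d.+1).
Hypotheses (d_gt1 : (1 < d)%N) (f_monic : f \is monic).

Local Notation M := {mpoly K[3]}.
Local Notation eqn := (dan_equation f phi).
Local Notation I := (dan_ideal f phi_monic phi_size d_gt1).
Local Notation B := (danielewski f phi_monic phi_size d_gt1).
Local Notation X := (@varX K).
Local Notation Y := (@varY K).
Local Notation Z := (@varZ K).

(** The projection, typed with the algebra [danielewski] as its codomain, so that
it is a ring morphism into that algebra. *)
Definition dan_pi : M -> B := \pi_{ideal_quot I}.
HB.instance Definition _ := GRing.RMorphism.on dan_pi.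

Lemma dan_pi_scale c p : dan_pi (c *: p) = c *: dan_pi p.
Proof. by rewrite [RHS](pi_scale I c p). Qed.

Lemma dan_piA (c : K) : dan_pi c%:A = c%:A.
Proof. by rewrite dan_pi_scale rmorph1. Qed.

Lemma dan_pi_eq p q : dan_pi p = dan_pi q <-> exists a, p - q = a * eqn.
Proof.
split=> [pq | [a pq]].
  have : p - q \in I by rewrite Quotient.idealrBE; apply/eqP.
  by rewrite unfold_in => /asboolP.
by apply/eqP; rewrite -Quotient.idealrBE unfold_in; apply/asboolP; exists a.
Qed.

Lemma dan_pi_surj b : exists p, b = dan_pi p.
Proof. by exists (repr b); rewrite /dan_pi reprK. Qed.

Local Notation xB := (dan_pi X).
Local Notation yB := (dan_pi Y).
Local Notation zB := (dan_pi Z).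

Lemma dan_pi_evxz P : dan_pi (evxz X Z P) = evxz xB zB P.
Proof. exact: (evxz_morph (g := dan_pi)) dan_piA P. Qed.

Lemma dan_pi_horner p : dan_pi (horner_alg X p) = horner_alg xB p.
Proof. by rewrite -(evxzC X Z) dan_pi_evxz evxzC. Qed.

Lemma dan_eqnE : eqn = horner_alg X f * Y - evxz X Z phi.
Proof. by []. Qed.

Lemma dan_relation : horner_alg xB f * yB = evxz xB zB phi.
Proof.
rewrite -dan_pi_evxz -dan_pi_horner -rmorphM.
by apply/dan_pi_eq; exists 1; rewrite mul1r.
Qed.

(** Sending Y to phi/f in the fraction field of K[X][Z] kills the equation and
fixes K[X][Z]. *)
Lemma dan_inj : injective (evxz xB zB).
Proof.
apply: raddf_inj => P /=; rewrite -dan_pi_evxz -(rmorph0 dan_pi).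
move/dan_pi_eq => [a]; rewrite subr0 => PE.
pose L := {fraction {poly {poly K}}}.
pose v (i : 'I_3) : L := if i == inord 0 then ('X%:P)%:F else
  if i == inord 1 then phi%:F / (f%:P)%:F else 'X%:F.
pose c0 : {rmorphism K -> L} := (@tofrac _ \o @polyC {poly K}) \o @polyC K.
pose ev : {rmorphism M -> L} := mmap c0 v.
have evX : ev X = ('X%:P)%:F by rewrite /ev /= /varX mmapX mmap1U /v eqxx.
have evY : ev Y = phi%:F / (f%:P)%:F.
  by rewrite /ev /= /varY mmapX mmap1U /v !inord3_eq.
have evZ : ev Z = 'X%:F by rewrite /ev /= /varZ mmapX mmap1U /v !inord3_eq.
have evE : ev \o evxz X Z =1 @tofrac _.
  apply: bipoly_morph_ext => [c||] /=.
  - by rewrite evxzC horner_algC alg_mpolyC mmapC.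
  - by rewrite evxzC horner_algX evX.
  - by rewrite evxzX evZ.
have f0 : (f%:P)%:F != 0 :> L by rewrite tofrac_eq0 polyC_eq0 monic_neq0.
have : ev (evxz X Z P) = 0.
  rewrite PE rmorphM dan_eqnE rmorphB rmorphM evY -(evxzC X Z) -/((ev \o evxz X Z) _).
  by rewrite evE -/((ev \o evxz X Z) phi) evE [_ * (_ / _)]mulrC divfK // subrr mulr0.
by rewrite -/((ev \o evxz X Z) P) evE => /eqP; rewrite tofrac_eq0 => /eqP.
Qed.

(** Reordering the variables turns a polynomial in X, Y, Z into one in Y over
K[X][Z]. *)
Lemma dan_generated (b : B) :
  exists Q : {poly {poly {poly K}}}, b = (map_poly (evxz xB zB) Q).[yB].
Proof.
have [p ->] := dan_pi_surj b.
have ycomm : commr_rmorph (evxz xB zB) yB by move=> a; apply: mulrC.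
pose v (i : 'I_3) : {poly {poly {poly K}}} := if i == inord 0 then 'X%:P%:P else
  if i == inord 1 then 'X else 'X%:P.
pose c0 : {rmorphism K -> {poly {poly {poly K}}}} :=
  (@polyC {poly {poly K}} \o @polyC {poly K}) \o @polyC K.
exists (mmap c0 v p).
rewrite -/(horner_morph ycomm _).
have := @mpoly_morph_ext K 3 B dan_pi (horner_morph ycomm \o mmap c0 v).
apply=> [c|i] /=.
  by rewrite mmapC /= horner_morphC /= evxzC horner_algC -alg_mpolyC dan_piA.
rewrite mmapX mmap1U /v; case: (ord3_cases i) => ->; rewrite !inord3_eq //=.
- by rewrite horner_morphC /= evxzC horner_algX.
- by rewrite horner_morphX.
- by rewrite horner_morphC /= evxzX.
Qed.

(** The Jacobian derivation f d/dZ + phi_Z d/dY annihilates f Y - phi, hence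
descends to the quotient. *)
Definition ambient_der (p : M) : M :=
  evxz X Z phi^`() * p^`M(inord 1) + horner_alg X f * p^`M(inord 2).

Lemma ambient_der_linear : linear ambient_der.
Proof.
move=> c p q; rewrite /ambient_der !linearP /= !mulrDr scalerDr -!scalerAr.
by rewrite addrACA.
Qed.
HB.instance Definition _ := GRing.isLinear.Build K M M _ ambient_der ambient_der_linear.

Lemma ambient_derM p q : ambient_der (p * q) = ambient_der p * q + p * ambient_der q.
Proof. by rewrite /ambient_der !mderivM; ring. Qed.

Lemma mderiv_var i j : ('X_j : M)^`M(i) = (i == j)%:R.
Proof.
rewrite mderivX mnm1E eq_sym; case: eqP => [->|]; last by rewrite scale0r.
have -> : (U_(j) - U_(j) = 0 :> 'X_{1..3})%MM.
  by apply/mnmP => k; rewrite mnmBE mnm0E subnn.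
by rewrite scale1r mpolyX0.
Qed.

Lemma ambient_derX : ambient_der X = 0.
Proof. by rewrite /ambient_der !mderiv_var !inord3_eq // !mulr0 addr0. Qed.

Lemma ambient_derY : ambient_der Y = evxz X Z phi^`().
Proof. by rewrite /ambient_der !mderiv_var !inord3_eq // mulr0 mulr1 addr0. Qed.

Lemma ambient_derZ : ambient_der Z = horner_alg X f.
Proof. by rewrite /ambient_der !mderiv_var !inord3_eq // mulr0 mulr1 add0r. Qed.

Lemma ambient_der_eqn : ambient_der eqn = 0.
Proof.
rewrite dan_eqnE linearB /= ambient_derM (der_adjoin X (D := ambient_der)) /=;
  last exact: ambient_derM.
rewrite (der_evxz X Z (D := ambient_der)) /=; last exact: ambient_derM.
rewrite ambient_derX ambient_derY ambient_derZ; ring.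
Qed.

Definition dan_der (b : B) : B := dan_pi (ambient_der (repr b)).

Lemma dan_der_pi p : dan_der (dan_pi p) = dan_pi (ambient_der p).
Proof.
have : dan_pi (repr (dan_pi p)) = dan_pi p by rewrite /dan_pi reprK.
move/dan_pi_eq => [a aE]; apply/dan_pi_eq; exists (ambient_der a).
by rewrite -linearB /= aE ambient_derM ambient_der_eqn mulr0 addr0.
Qed.

Lemma dan_der_linear : linear dan_der.
Proof.
move=> c u v; have [p ->] := dan_pi_surj u; have [q ->] := dan_pi_surj v.
by rewrite -dan_pi_scale -rmorphD !dan_der_pi linearP rmorphD /= dan_pi_scale.
Qed.
HB.instance Definition _ := GRing.isLinear.Build K B B _ dan_der dan_der_linear.

Lemma dan_der_derivation : is_derivation dan_der.
Proof.
move=> u v; have [p ->] := dan_pi_surj u; have [q ->] := dan_pi_surj v.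
by rewrite -rmorphM /= !dan_der_pi ambient_derM rmorphD !rmorphM.
Qed.

End Danielewski.

Theorem theorem12 (K : closedFieldType) (charK0 : [pchar K] =i pred0)
  (r : nat) (r_gt1 : (1 < r)%N)
  (f : {poly K}) (f_monic : f \is monic) (f_size : size f = r.+1)
  (d : nat) (d_gt1 : (1 < d)%N)
  (phi : {poly {poly K}}) (phi_monic : phi \is monic)
  (phi_size : size phi = d.+1) :
  derksen_invariant (danielewski f phi_monic phi_size d_gt1)
  = adjoin (dan_x f phi_monic phi_size d_gt1).
Proof.
apply: (surface_derksen charK0 r_gt1 d_gt1 f_monic f_size phi_monic phi_size
  (dan_relation _ _ _ _) (@dan_inj _ f phi d phi_monic phi_size d_gt1 f_monic)
  (@dan_generated _ _ _ _ _ _ _) (@dan_der_derivation _ f phi d _ _ _)).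
- by rewrite /= dan_der_pi ambient_derX rmorph0.
- by rewrite /= dan_der_pi ambient_derZ dan_pi_horner.
Qed.
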